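(* Let $D$ be an integral domain. The following are equivalent: (1) $D$ is both an IDF domain and an MCD-finite domain; (2) the polynomial ring $D[X]$ in one indeterminate is an IDF domain; (3) for every set $\overline{X}$ of indeterminates, the polynomial ring $D[\overline{X}]$ is an IDF domain.
   Context: Integral domains are commutative with identity. For a domain $D$, $D^*$ denotes the set of non-zero elements and $U(D)$ the group of units. For $x,y\in D$, $x\mid y$ means $y=xz$ for some $z\in D$; $x,y$ are associates ($x\sim y$) if $x=uy$ for some $u\in U(D)$. An atom is an irreducible element (a non-zero non-unit that is not a product of two non-units). $D$ is an IDF domain if every non-zero element of $D$ has only a finite number (possibly zero) of pairwise non-associate irreducible divisors. For $S\subseteq D^*$, a common divisor of $S$ is an element $x\in D^*$ with $x\mid s$ for every $s\in S$. A common divisor $c$ of $S$ is a maximal common divisor (MCD) of $S$ if for every common divisor $d$ of $S$, $c\mid d$ implies $c\sim d$. $D$ is MCD-finite if every finite subset of $D^*$ has, up to associates, only finitely many (possibly zero) maximal common divisors. *)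

(* Defs.v *)
From HB Require Import structures.
From mathcomp Require Import all_boot all_order all_algebra.
From mathcomp Require Import finmap.
From mathcomp.multinomials Require Import monalg.

Set Implicit Arguments.
Unset Strict Implicit.
Unset Printing Implicit Defensive.

Import GRing.Theory.

Local Open Scope ring_scope.

(* {malg R[{cmonom I}]} is only equipped with a commutative ring structure
   (no unitRingType or idomainType instance), hence the generality of the
   notions below and the use of [is_unit] in place of [GRing.unit]. *)
Section Divisibility.

Context {R : comNzRingType}.
Implicit Types x y z c d : R.

Definition is_unit x : Prop := exists y, x * y = 1.

Definition divides x y : Prop := exists z, y = x * z.

Definition associates x y : Prop := exists2 u, is_unit u & x = u * y.

Definition atom x : Prop :=
  [/\ x <> 0, ~ is_unit x
    & forall y z, ~ is_unit y -> ~ is_unit z -> x <> y * z].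

(* [s] lists elements of [P], meeting every class of associates of [P];
   repetitions of a class in [s] are harmless. *)
Definition finite_upto_associates (P : R -> Prop) : Prop :=
  exists s : seq R,
    (forall q, q \in s -> P q) /\
    (forall p, P p -> exists2 q, q \in s & associates p q).

Definition common_divisor (S : {pred R}) x : Prop :=
  x <> 0 /\ forall y, y \in S -> divides x y.

Definition maximal_common_divisor (S : {pred R}) c : Prop :=
  common_divisor S c /\
  forall d, common_divisor S d -> divides c d -> associates c d.

End Divisibility.

Lemma is_unitE (R : comUnitRingType) (x : R) :
  is_unit x <-> x \is a GRing.unit.
Proof.
split=> [[y xy1]|ux]; last by exists x^-1; rewrite divrr.
by apply/unitrPr; exists y.
Qed.

Definition IDF_domain (R : comNzRingType) : Prop :=
  GRing.integral_domain_axiom R /\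
  forall x : R, x <> 0 ->
    finite_upto_associates (fun p => atom p /\ divides p x).

Definition MCD_finite_domain (R : comNzRingType) : Prop :=
  GRing.integral_domain_axiom R /\
  forall S : {fset R}, 0 \notin S ->
    finite_upto_associates (maximal_common_divisor (mem S)).

(* Main.v *)
Require Import Defs.
From HB Require Import structures.
From mathcomp Require Import all_boot all_order all_algebra.
From mathcomp Require Import finmap.
From mathcomp.multinomials Require Import monalg.
From Stdlib Require Import Classical_Prop.

Set Implicit Arguments.
Unset Strict Implicit.
Unset Printing Implicit Defensive.

Import GRing.Theory.

Local Open Scope ring_scope.

(** Let K be the fraction field of D.

    From D to D[X].  Call a common divisor c of a finite set S of polynomials
    constant-maximal if no non-unit constant e makes e * c a common divisor
    again.  If D is MCD-finite there are finitely many of these up to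
    associates ([finite_constant_maximal_divisors]).  Indeed, c divides a fixed
    member of S, so it meets one of finitely many classes of associates of
    K[X] ([finite_eqp_divisors]).  Inside the class of c0, c is determined by
    its leading coefficient l.  Writing l0 for the leading coefficient of c0,
    the polynomials l * (f / c) = l0 * (f / c0), for f in S, do not depend
    on c, and the constant-maximality of c says precisely that l is a maximal
    common divisor of all their coefficients.  Hence finitely many l, up to
    units of D.

    This has two consequences.  A maximal common divisor is constant-maximal,
    so D[X] is again MCD-finite ([MCD_finite_poly]).  If g is a non-constant
    atom dividing f, then no non-unit constant divides g, i.e. the cofactor
    f / g is constant-maximal for {f}; thus f has finitely many such atoms, and its
    constant atomic divisors divide the leading coefficient of f
    ([IDF_poly]).

    From D[X] back to D.  Constants have only constant divisors, so D inherits
    the IDF property ([IDF_of_poly]).  Let f be a polynomial with set of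
    coefficients S, and c a maximal common divisor of S.  Then f / c has no
    non-unit constant divisor, so it is a product of boundedly many atoms, each
    of them dividing f.  If f has finitely many atomic divisors, that
    leaves finitely many possible f / c, hence finitely many c
    ([MCD_finite_of_poly]).

    Arbitrary sets of variables.  The two conditions on D pass to D[X], hence to
    every iterated polynomial ring.  The polynomials of D[I] involving only
    a given finite set J of variables form a copy of such an iterated ring
    ([presentation]), and this subring contains all divisors of its non-zero
    elements ([supported_divisor]).  Every polynomial lives in one of these
    subrings, so D[I] is an IDF domain ([IDF_malg]). *)

(** * Finiteness up to associates *)

Lemma seq_choice (X : eqType) (Y : Type) (y0 : Y) (P : X -> Y -> Prop)
    (s : seq X) :
  (forall x, x \in s -> exists y, P x y) ->
  exists g : X -> Y, forall x, x \in s -> P x (g x).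
Proof.
elim: s => [|a s IHs] sP; first by exists (fun=> y0).
have [g gP] := IHs (fun x xs => sP x (mem_behead (s := a :: s) xs)).
have [b bP] := sP a (mem_head _ _).
exists (fun x => if x == a then b else g x) => x.
by rewrite inE; case: eqP => [->|_ /gP].
Qed.

Section Associates.

Context {R : comNzRingType}.
Implicit Types x y z p q : R.

Lemma is_unitM x y : is_unit (x * y) <-> is_unit x /\ is_unit y.
Proof.
split=> [[z xyz1]|[[x' xx'] [y' yy']]].
  by split; [exists (y * z) | exists (x * z)]; rewrite mulrA // (mulrC y).
by exists (x' * y'); rewrite mulrACA xx' yy' mulr1.
Qed.

Lemma is_unit1 : is_unit (1 : R).
Proof. by exists 1; rewrite mulr1. Qed.

Lemma associates_refl x : associates x x.
Proof. by exists 1; [exact: is_unit1 | rewrite mul1r]. Qed.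

Lemma associates_sym x y : associates x y -> associates y x.
Proof.
case=> u [v uv1] ->; exists v; last by rewrite mulrA (mulrC v) uv1 mul1r.
by exists u; rewrite mulrC.
Qed.

Lemma associates_trans y x z :
  associates x y -> associates y z -> associates x z.
Proof.
case=> u uU -> [v vU ->]; exists (u * v); last by rewrite mulrA.
by apply/is_unitM.
Qed.

Lemma associatesM x y x' y' :
  associates x x' -> associates y y' -> associates (x * y) (x' * y').
Proof.
case=> u uU -> [v vU ->]; exists (u * v); last by rewrite mulrACA.
by apply/is_unitM.
Qed.

Lemma divides_refl x : divides x x.
Proof. by exists 1; rewrite mulr1. Qed.

Lemma divides_trans y x z : divides x y -> divides y z -> divides x z.
Proof. by case=> a -> [b ->]; exists (a * b); rewrite mulrA. Qed.

(** The labels in [s] need not be compatible with associates: one element may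
    carry several labels, and a label may be carried by nothing. *)
Lemma finite_upto_associates_cover (T : eqType) (s : seq T)
    (Q : T -> R -> Prop) (P : R -> Prop) :
    (forall p, P p -> exists2 t, t \in s & Q t p) ->
    (forall t, t \in s -> finite_upto_associates (fun p => P p /\ Q t p)) ->
  finite_upto_associates P.
Proof.
move=> sP sQ.
suff [l [lP lC]] : exists l : seq R, (forall q, q \in l -> P q) /\
    forall t p, t \in s -> P p -> Q t p -> exists2 q, q \in l & associates p q.
  exists l; split=> // p Pp; have [t ts Qtp] := sP p Pp.
  exact: lC ts Pp Qtp.
elim: s {sP} sQ => [|t s IHs] sQ; first by exists [::]; split.
case: IHs => [t' t's|l [lP lC]]; first by apply: sQ; rewrite inE t's orbT.
have [l' [l'P l'C]] := sQ t (mem_head _ _).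
exists (l' ++ l); split=> [q|t' p].
  by rewrite mem_cat => /orP[/l'P[]|/lP].
rewrite inE => /orP[/eqP->|t's] Pp Qp.
  by have [|q ql qC] := l'C p; [split | exists q; rewrite // mem_cat ql].
by have [q ql qC] := lC t' p t's Pp Qp; exists q; rewrite // mem_cat ql orbT.
Qed.

Lemma finite_upto_associates_label (T : eqType) (s : seq T)
    (Q : T -> R -> Prop) (P : R -> Prop) :
    (forall p, P p -> exists2 t, t \in s & Q t p) ->
    (forall t p p', P p -> P p' -> Q t p -> Q t p' -> associates p p') ->
  finite_upto_associates P.
Proof.
move=> sP Qinj; apply: (finite_upto_associates_cover sP) => t _.
have [[p [Pp Qp]]|noP] := classic (exists p, P p /\ Q t p); last first.
  by exists [::]; split=> // p PQp; case: noP; exists p.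
exists [:: p]; split=> [q|q [Pq Qq]]; first by rewrite inE => /eqP->.
by exists p; [exact: mem_head | exact: (Qinj t)].
Qed.

End Associates.

Section Domain.

Context {R : idomainType}.
Implicit Types x y z c : R.

Lemma integral_domain : GRing.integral_domain_axiom R.
Proof. by move=> x y /eqP; rewrite mulf_eq0. Qed.

Lemma associatesMl x y z :
  x <> 0 -> associates (x * y) (x * z) -> associates y z.
Proof.
move=> /eqP x0 [u uU uE]; exists u => //; apply: (mulfI x0).
by rewrite uE mulrCA.
Qed.

Lemma dividesMl x y z : x <> 0 -> divides (x * y) (x * z) -> divides y z.
Proof.
move=> /eqP x0 [w wE]; exists w; apply: (mulfI x0).
by rewrite wE mulrA.
Qed.

Lemma associates_cofactor x a b c d :
  x <> 0 -> x = a * b -> x = c * d -> associates a c -> associates b d.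
Proof.
move=> x0 xab xcd [u uU aE].
have c0 : c != 0 by apply/eqP => c0; case: x0; rewrite xcd c0 mul0r.
have [v uv1] := uU; exists v; first by exists u; rewrite mulrC.
apply: (mulfI c0); rewrite mulrCA -xcd xab aE.
by rewrite !mulrA (mulrC v) uv1 mul1r.
Qed.

(** Every non-zero element is a common divisor of the empty set, so two maximal
    ones are both associates of their product. *)
Lemma finite_MCD_empty (S : {pred R}) :
  (forall y, y \notin S) -> finite_upto_associates (maximal_common_divisor S).
Proof.
move=> S_.
apply: (finite_upto_associates_label (s := [:: tt]) (Q := fun _ _ => True)).
  by move=> c _; exists tt.
move=> _ c c' [[c0 _] cmax] [[c'0 _] c'max] _ _.
have cc'S : common_divisor S (c * c').
  split=> [|y yS]; last by have := S_ y; rewrite yS.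
  by apply/eqP; rewrite mulf_neq0 //; apply/eqP.
apply: associates_trans (cmax _ cc'S _) _; first by exists c'.
apply: associates_sym; apply: c'max => //.
by exists c; rewrite mulrC.
Qed.

End Domain.

(** * Divisor-closed embeddings *)

(** A divisor of a non-zero element of the subring [R] of [A] lies in [R], so
    units, divisibility and atoms below such an element are the same in both
    rings. Two cases matter: constants among polynomials, and polynomials in
    some of the variables among polynomials in all of them. *)
Section Embedding.

Context {R A : comNzRingType} (phi : {rmorphism R -> A}).
Hypothesis phi_inj : injective phi.
Hypothesis phi_closed :
  forall x y z, z <> 0 -> x * y = phi z -> exists x', x = phi x'.

Lemma embedding_is_unit x : is_unit (phi x) <-> is_unit x.
Proof.
split=> [[y xy1]|[y xy1]]; last by exists (phi y); rewrite -rmorphM xy1 rmorph1.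
have [y' yE] : exists y', y = phi y'.
  apply: (phi_closed (y := phi x) (z := 1)); first by apply/eqP/oner_neq0.
  by rewrite mulrC rmorph1.
by exists y'; apply: phi_inj; rewrite rmorphM rmorph1 -yE.
Qed.

Lemma embedding_divides x y :
  y <> 0 -> divides (phi x) (phi y) <-> divides x y.
Proof.
move=> y0; split=> [[z yE]|[z ->]]; last by exists (phi z); rewrite rmorphM.
have [z' zE] : exists z', z = phi z'.
  by apply: (phi_closed (y := phi x) y0); rewrite mulrC.
by exists z'; apply: phi_inj; rewrite rmorphM -zE.
Qed.

Lemma embedding_associates x y : associates (phi x) (phi y) -> associates x y.
Proof.
case=> u [v uv1] xE.
have [u' uE] : exists u', u = phi u'.
  apply: (phi_closed (y := v) (z := 1)); last by rewrite rmorph1.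
  exact/eqP/oner_neq0.
exists u'; first by apply/embedding_is_unit; rewrite -uE; exists v.
by apply: phi_inj; rewrite rmorphM -uE.
Qed.

Lemma embedding_atom x : atom (phi x) <-> atom x.
Proof.
split=> [[x0 xU xI]|[x0 xU xI]].
  split=> [x0'||y z yU zU xE]; first by apply: x0; rewrite x0' rmorph0.
    by move/embedding_is_unit.
  by apply: (xI (phi y) (phi z)); rewrite ?embedding_is_unit // xE rmorphM.
split=> [||y z yU zU xE]; first by rewrite -(rmorph0 phi) => /phi_inj.
  by move/embedding_is_unit.
have [y' yE] := phi_closed x0 (esym xE).
have [z' zE] : exists z', z = phi z'.
  by apply: (phi_closed (y := y) x0); rewrite mulrC.
move: yU zU; rewrite yE zE !embedding_is_unit => yU zU.
by apply: (xI _ _ yU zU); apply: phi_inj; rewrite rmorphM -yE -zE.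
Qed.

Lemma embedding_finite_atomic_divisors x : x <> 0 ->
  finite_upto_associates (fun p => atom p /\ divides p (phi x)) <->
  finite_upto_associates (fun p => atom p /\ divides p x).
Proof.
move=> x0; split=> -[s [sP sC]].
  apply: (@finite_upto_associates_label _ _ s
    (fun q p => associates (phi p) q)).
    by move=> p [pA px]; apply: sC; rewrite embedding_atom embedding_divides.
  move=> q p p' _ _ pq p'q; apply: embedding_associates.
  exact: associates_trans pq (associates_sym p'q).
exists (map phi s); split=> [_ /mapP[q /sP[qA qx] ->]|p [pA [z xE]]].
  by rewrite embedding_atom embedding_divides.
have [p' pE] := phi_closed x0 (esym xE).
have [|q qs [u [v uv] p'E]] := sC p'.
  rewrite -embedding_atom -(embedding_divides _ x0) -pE.
  by split=> //; exists z.
exists (phi q); first exact: map_f.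
rewrite pE p'E rmorphM; exists (phi u) => //.
by apply/embedding_is_unit; exists v.
Qed.

End Embedding.

(** * Constants in a polynomial ring *)

Section ConstantPolynomials.

Context {D : idomainType}.
Implicit Types (a b c e : D) (f g h p q : {poly D}).

Lemma polyC_divisor_closed p q a : a <> 0 -> p * q = a%:P -> exists b, p = b%:P.
Proof.
move=> /eqP a0 pqa; exists p`_0; apply: size1_polyC.
have: p * q != 0 by rewrite pqa polyC_eq0.
rewrite mulf_eq0 negb_or => /andP[p0 q0].
have := size_mul p0 q0; rewrite pqa size_polyC a0.
move: p0 q0; rewrite -!size_poly_gt0.
by case: (size p) => [|[|n]] //; case: (size q) => [|m] //; rewrite addSn addnS.
Qed.

Lemma polyC_is_unit a : is_unit a%:P <-> is_unit a.
Proof.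
exact: (@embedding_is_unit D {poly D} polyC polyC_inj polyC_divisor_closed).
Qed.

Lemma polyC_atom a : atom a%:P <-> atom a.
Proof.
exact: (@embedding_atom D {poly D} polyC polyC_inj polyC_divisor_closed).
Qed.

Lemma polyC_associates a b : associates a%:P b%:P <-> associates a b.
Proof.
split; last by case=> u uU ->; exists u%:P; rewrite ?polyC_is_unit ?polyCM.
exact: (@embedding_associates D {poly D} polyC polyC_inj polyC_divisor_closed).
Qed.

Lemma is_unit_size1 p : is_unit p -> size p = 1%N.
Proof. by move/is_unitE; rewrite poly_unitE => /andP[/eqP]. Qed.

Lemma polyC_divides e f :
  divides e%:P f <-> forall c, c \in (f : seq D) -> divides e c.
Proof.
split=> [[g ->] c /(nthP 0)[i _ <-]|]; first by rewrite coefCM; exists g`_i.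
elim/poly_ind: f => [_|f c IHf]; first by exists 0; rewrite mulr0.
move=> fE.
have coefE i : divides e (f * 'X + c%:P)`_i.
  have [ilt|ige] := ltnP i (size (f * 'X + c%:P)); first exact/fE/mem_nth.
  by exists 0; rewrite mulr0 nth_default.
have [_ /(nthP 0)[i _ <-]|g gE] := IHf.
  by have := coefE i.+1; rewrite coefD coefMX coefC addr0.
have [c' cE] := coefE 0; move: cE; rewrite coefD coefMX coefC add0r => cE.
by exists (g * 'X + c'%:P); rewrite mulrDr mulrA -gE -polyCM -cE.
Qed.

End ConstantPolynomials.

(** * Divisors up to fractions *)

Section FractionClasses.

Context {D : idomainType}.
Implicit Types (f g h d : {poly D}).

(** Over an integral domain [%|] and [%=] are divisibility and association in
    the polynomial ring over the fraction field. A divisor of a product h * g is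
    the product of its gcd with g and of a divisor of h; hence the finiteness
    follows by induction on the degree, whenever f has a factor of
    intermediate degree, and is clear when it has none. *)
Lemma finite_eqp_divisors f : f != 0 ->
  exists s : seq {poly D}, forall d, d %| f -> exists2 e, e \in s & d %= e.
Proof.
have [n] := ubnP (size f); elim: n f => // n IHn f; rewrite ltnS => le_fn f0.
have [[g [gf g1 gltf]]|triv] := classic
  (exists g, [/\ g %| f, size g != 1%N & (size g < size f)%N]); last first.
  exists [:: 1; f] => d df; have [d1|d1] := eqVneq (size d) 1%N.
    by exists 1; [exact: mem_head | rewrite -size_poly_eq1 d1].
  exists f; first by rewrite !inE eqxx orbT.
  rewrite -(dvdp_size_eqp df) eqn_leq dvdp_leq //= leqNgt.
  by apply/negP => dltf; apply: triv; exists d.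
have g0 : g != 0 := dvdpN0 gf f0.
set h := f %/ g.
have fE : f %= h * g.
  rewrite -(eqP (etrans (esym (Pdiv.Idomain.dvdp_eq g f)) gf)) eqp_sym.
  by rewrite eqp_scale // expf_neq0 // lead_coef_eq0.
have h0 : h != 0.
  by apply: contraNneq f0 => h0; move: fE; rewrite h0 mul0r eqp0.
have hltf : (size h < size f)%N.
  have := eqp_size fE; rewrite size_mul // => ->.
  have: (1 < size g)%N by rewrite ltn_neqAle eq_sym g1 size_poly_gt0.
  by case: (size g) => [|[|k]] // _; rewrite !addnS /= ltnS leq_addr.
have [s1 s1P] := IHn g (leq_trans gltf le_fn) g0.
have [s2 s2P] := IHn h (leq_trans hltf le_fn) h0.
exists [seq d1 * d2 | d1 <- s1, d2 <- s2] => d df.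
(* The gcd exists over fractions, although it may not over D. *)
set d1 := gcdp d g; set d2 := d %/ d1.
have d0 : d != 0 := dvdpN0 df f0.
have d10 : d1 != 0 by rewrite gcdp_eq0 negb_and d0.
have dE : d %= d2 * d1.
  rewrite -(eqP (etrans (esym (Pdiv.Idomain.dvdp_eq d1 d)) (dvdp_gcdl _ _))).
  by rewrite eqp_sym eqp_scale // expf_neq0 // lead_coef_eq0.
have d2h : d2 %| h.
  rewrite -(dvdp_mul2r _ _ d10) -(eqp_dvdl _ dE).
  rewrite (eqp_dvdr _ (mulp_gcdr d g h)) dvdp_gcd dvdp_mull //=.
  by rewrite -(eqp_dvdr _ fE).
have [e1 e1s de1] := s1P d1 (dvdp_gcdr _ _).
have [e2 e2s de2] := s2P d2 d2h.
exists (e1 * e2); first by apply/allpairsP; exists (e1, e2).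
apply: eqp_trans dE _; rewrite mulrC.
exact: eqp_trans (eqp_mulr _ de1) (eqp_mull _ de2).
Qed.

End FractionClasses.

(** * Ascent to the polynomial ring *)

Section ConstantMaximal.

Context {D : idomainType}.
Implicit Types (c f g h : {poly D}).

(** Weaker than being a maximal common divisor, in order to apply also to the
    cofactors of non-constant atoms. *)
Definition constant_maximal_divisor (S : {pred {poly D}}) c : Prop :=
  common_divisor S c /\
  forall e : D, common_divisor S (e%:P * c) -> is_unit e.

Lemma mem_coef (p : {poly D}) i : p`_i != 0 -> p`_i \in (p : seq D).
Proof.
move=> pi0; apply: mem_nth; rewrite ltnNge; apply: contraNN pi0 => ?.
by rewrite nth_default.
Qed.

(** Among divisors of [f] that differ by fractions, constant-maximality leaves
    no freedom but the choice of the leading coefficient as a maximal common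
    divisor of a fixed finite set [T] of elements of [D]. *)
Lemma finite_constant_maximal_divisors (S : {fset {poly D}}) f :
    MCD_finite_domain D -> 0 \notin S -> f \in S ->
  finite_upto_associates (constant_maximal_divisor (mem S)).
Proof.
move=> [_ mcdD] S0 fS.
have f0 : f != 0 by apply: contraNneq S0 => <-.
have [s sP] := finite_eqp_divisors f0.
apply: (finite_upto_associates_cover (s := s) (Q := fun t c => c %= t)).
  move=> c [[_ cS] _]; have [h fE] := cS f fS.
  have [|e es ce] := sP c; first by rewrite fE dvdp_mulIl.
  by exists e.
move=> t _.
have [[c0 [[[/eqP c00 c0S] _] c0t]]|none] := classic
  (exists c, constant_maximal_divisor (mem S) c /\ c %= t); last first.
  by exists [::]; split=> // c cP; case: none; exists c.
have [g gE] := seq_choice 0 (c0S : forall f, f \in enum_fset S -> divides c0 f).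
pose l0 := lead_coef c0.
(* The non-zero coefficients of the polynomials l0 * (f / c0), f in S. *)
pose T := [fset x in flatten [seq (l0 *: g f : seq D) | f <- S] | x != 0]%fset.
have T0 : 0 \notin T by rewrite !inE /= eqxx andbF.
have [s' [s'P s'C]] := mcdD T T0.
apply: (finite_upto_associates_label (s := s')
  (Q := fun l c => associates (lead_coef c) l)); last first.
  move=> l c c' [_ ct] [[[/eqP c'0 _] _] c't] cl c'l.
  have [u uU uE] := associates_trans cl (associates_sym c'l).
  exists u%:P; first exact/polyC_is_unit.
  have c'0' : (lead_coef c')%:P != 0 by rewrite polyC_eq0 lead_coef_eq0.
  apply: (mulfI c'0').
  rewrite mul_polyC (eqp_eq (eqp_trans ct _)) 1?eqp_sym // uE.
  by rewrite -mul_polyC polyCM mulrA (mulrC u%:P).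
(* The leading coefficient of [c] is a maximal common divisor of [T]. *)
move=> c [[[/eqP c_0 cS] cmax] ct]; apply: s'C.
pose l := lead_coef c.
have l_0 : l != 0 by rewrite lead_coef_eq0.
(* Hence the quotients of [S] by [c], scaled by [l], do not depend on [c]. *)
have quotE f' h : f' \in S -> f' = c * h -> l *: h = l0 *: g f'.
  move=> f'S f'E; apply: (mulfI c00).
  rewrite -scalerAr scalerAl (eqp_eq (eqp_trans c0t _)) 1?eqp_sym //.
  by rewrite -scalerAl -f'E -scalerAr -gE.
split.
  split=> [|x]; first exact/eqP.
  rewrite !inE /= => /andP[/flatten_mapP[f' f'S xf'] _].
  have [h f'E] := cS f' f'S.
  move: xf'; rewrite -(quotE f' h) // => /(nthP 0)[i _ <-].
  by rewrite coefZ; exists h`_i.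
move=> d [d0 dT] [e dE].
have [|v ev1] := cmax e; last first.
  exists v; first by exists e; rewrite mulrC.
  by rewrite dE mulrCA (mulrC v) ev1 mulr1.
have e0 : e != 0 by apply/eqP => e0; apply: d0; rewrite dE e0 mulr0.
split=> [|f' f'S]; first by apply/eqP; rewrite mulf_neq0 ?polyC_eq0.
have [h f'E] := cS f' f'S.
suff [k hE] : divides e%:P h by exists k; rewrite f'E hE mulrA (mulrC c).
apply/polyC_divides => a /(nthP 0)[i _ aE].
have [a0|a0] := eqVneq a 0; first by exists 0; rewrite mulr0.
have l_0' : l <> 0 by exact/eqP.
apply: (dividesMl l_0'); rewrite -dE; apply: dT.
rewrite !inE /= mulf_neq0 // andbT; apply/flatten_mapP; exists f' => //.
have laE : l * a = (l0 *: g f')`_i by rewrite -(quotE f' h) // coefZ aE.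
by rewrite laE mem_coef // -laE mulf_neq0.
Qed.

Lemma MCD_finite_poly : MCD_finite_domain D -> MCD_finite_domain {poly D}.
Proof.
move=> mcdD; split=> [|S S0]; first exact: integral_domain.
have [S_|[f fS]] := fset_0Vmem S; last first.
  have [s [sP sC]] := finite_constant_maximal_divisors mcdD S0 fS.
  apply: (finite_upto_associates_label (s := s)
    (Q := fun t c => associates c t)).
    move=> c [cS cmax]; apply: sC; split=> // e ecS.
    have [|u [v uv1] cE] := cmax _ ecS; first by exists e%:P; rewrite mulrC.
    have c0 : c != 0 by apply/eqP; case: cS.
    apply/polyC_is_unit; exists u; apply: (mulIf c0).
    by rewrite mul1r -mulrA mulrCA -cE.
  by move=> t c c' _ _ ct c't; apply: associates_trans ct (associates_sym c't).
by apply: finite_MCD_empty => y; rewrite S_.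
Qed.

(** An atom [p] dividing [f] is treated according to its degree: a constant one
    is an atomic divisor of the leading coefficient of [f], while a non-constant
    one is determined by its cofactor, which is constant-maximal for [f]. *)
Lemma IDF_poly :
  IDF_domain D -> MCD_finite_domain D -> IDF_domain {poly D}.
Proof.
move=> [_ idfD] mcdD; split=> [|f f0]; first exact: integral_domain.
have lf0 : lead_coef f <> 0 by apply/eqP; rewrite lead_coef_eq0; apply/eqP.
have [s [sP sC]] := idfD (lead_coef f) lf0.
have S0 : 0 \notin [fset f]%fset by rewrite inE eq_sym; apply/eqP.
have [s' [s'P s'C]] := finite_constant_maximal_divisors mcdD S0 (fset11 f).
apply: (finite_upto_associates_cover (s := [:: true; false])
  (Q := fun b (p : {poly D}) => b = (size p == 1%N))) => [p _|[] _].
- by exists (size p == 1%N) => //; case: (_ == _).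
- apply: (finite_upto_associates_label (s := s)
    (Q := fun t p => associates p t%:P)).
    move=> p [[pA [q fE]] /esym /eqP/eq_leq/size1_polyC pE].
    have [|t ts pt] := sC p`_0.
      rewrite -polyC_atom -pE.
      split=> //; exists (lead_coef q).
      by rewrite fE lead_coefM {1}pE lead_coefC.
    by exists t => //; rewrite pE polyC_associates.
  move=> t p p' _ _ pt p't; exact: associates_trans pt (associates_sym p't).
- apply: (finite_upto_associates_label (s := s')
    (Q := fun t p => exists2 h, f = p * h & associates h t)).
    move=> p [[[p0 pU pI] [h fE]] /esym /eqP p1].
    have [|t ts ht] := s'C h; last by exists t => //; exists h.
    have h0 : h <> 0 by move=> h0; apply: f0; rewrite fE h0 mulr0.
    split=> [|e [eh0 eS]].
      by split=> // y; rewrite inE => /eqP->; exists p; rewrite mulrC.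
    have [k fE'] := eS f (fset11 f).
    have pE : p = e%:P * k.
      by apply: (mulIf (introN eqP h0)); rewrite -fE fE' mulrAC.
    apply: NNPP => eU; apply: (pI e%:P k) => //; first by move/polyC_is_unit.
    move=> /is_unit_size1 k1; apply: p1.
    have e0 : e != 0.
      by apply/eqP => e0; apply: eh0; rewrite e0 polyC0 mul0r.
    by rewrite pE mul_polyC size_scale.
  move=> t p p' _ _ [h fE ht] [h' fE' h't].
  apply: (associates_cofactor f0 (a := h) (c := h')); rewrite 1?mulrC //.
  exact: associates_trans ht (associates_sym h't).
Qed.

End ConstantMaximal.

(** * Descent from the polynomial ring *)

Section Descent.

Context {D : idomainType}.
Implicit Types (f g p q : {poly D}).

Lemma IDF_of_poly : IDF_domain {poly D} -> IDF_domain D.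
Proof.
move=> [_ idfP]; split=> [|x x0]; first exact: integral_domain.
apply/(@embedding_finite_atomic_divisors D {poly D} polyC polyC_inj
  polyC_divisor_closed x x0).
by apply: idfP => /eqP; rewrite polyC_eq0 => /eqP.
Qed.

Definition weakly_primitive f : Prop :=
  forall e : D, divides e%:P f -> is_unit e.

(** Non-unit factors of a weakly primitive polynomial are weakly primitive and
    non-constant, so splitting lowers the degree: [g] is a product of fewer than
    [size g] atoms. The list [s] consists of products of members of [A],
    among them all those of at most [n] factors. *)
Lemma weakly_primitive_products (A : seq {poly D}) n :
  exists s : seq {poly D}, forall g, g != 0 -> weakly_primitive g ->
    (size g <= n.+1)%N ->
    (forall p, atom p -> divides p g -> exists2 q, q \in A & associates p q) ->
  exists2 t, t \in s & associates g t.
Proof.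
elim: n => [|n [s sP]].
  exists [:: 1] => g _ gprim /size1_polyC gE _; exists 1; first exact: mem_head.
  exists g; last by rewrite mulr1.
  rewrite gE; apply/polyC_is_unit/gprim; rewrite -gE; exact: divides_refl.
exists (1 :: A ++ [seq x * y | x <- s, y <- s]) => g g0 gprim gsize gA.
have [gU|gU] := classic (is_unit g).
  by exists 1; [exact: mem_head | exists g; rewrite ?mulr1].
have [gAtom|gnAtom] := classic (atom g).
  have [q qA gq] := gA g gAtom (divides_refl g).
  by exists q; rewrite // inE mem_cat qA orbT.
have [[y [z [yU zU gE]]]|noFactor] :=
    classic (exists y z, [/\ ~ is_unit y, ~ is_unit z & g = y * z]); last first.
  case: gnAtom; split=> // [|y z yU zU gE]; first exact/eqP.
  by apply: noFactor; exists y, z.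
have small y' z' : ~ is_unit y' -> ~ is_unit z' -> g = y' * z' ->
    exists2 t, t \in s & associates y' t.
  move=> y'U z'U g'E.
  have big x : ~ is_unit x -> divides x g -> (1 < size x)%N.
    move=> xU xg; rewrite ltnNge; apply/negP => /size1_polyC xE.
    by apply: xU; rewrite xE polyC_is_unit; apply: gprim; rewrite -xE.
  have y'g : divides y' g by exists z'.
  have z'g : divides z' g by exists y'; rewrite mulrC.
  have /andP[y'0 z'0] : (y' != 0) && (z' != 0).
    by rewrite -negb_or -mulf_eq0 -g'E.
  apply: sP => // [e ey'||p pA py'];
    last exact: gA pA (divides_trans py' y'g).
    by apply: gprim; apply: divides_trans ey' y'g.
  move: gsize (big _ z'U z'g); rewrite g'E size_mul //.
  case: (size z') => [|[|k]] // + _.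
  by rewrite !addnS /= !ltnS => /(leq_trans (leq_addr _ _)).
have [t ts yt] := small y z yU zU gE.
have [t' t's zt'] := small z y zU yU (etrans gE (mulrC y z)).
exists (t * t'); last by rewrite gE; apply: associatesM.
rewrite inE mem_cat; apply/orP; right; apply/orP; right.
by apply/allpairsP; exists (t, t').
Qed.

(** A maximal common divisor [c] of the coefficients of [f] is recovered from
    the weakly primitive cofactor [g] in [f = c%:P * g], which is a product of
    atomic divisors of [f]. *)
Lemma MCD_finite_of_poly : IDF_domain {poly D} -> MCD_finite_domain D.
Proof.
move=> [_ idfP]; split=> [|S S0]; first exact: integral_domain.
have [S_|[a aS]] := fset_0Vmem S.
  by apply: finite_MCD_empty => y; rewrite S_.
pose f := Poly (enum_fset S).
have fE : f = enum_fset S :> seq D.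
  apply: (@PolyK _ 1); have := mem_last 1 (enum_fset S).
  rewrite inE => /orP[/eqP->|lS]; first exact: oner_neq0.
  by apply: contraNneq S0 => <-.
have f0 : f <> 0.
  move=> f0; move: aS.
  by rewrite -[a \in S]/(a \in enum_fset S) -fE f0 polyseq0.
have fP e : divides e%:P f <-> forall c, c \in S -> divides e c.
  by rewrite polyC_divides fE.
have [A [_ AC]] := idfP f f0.
have [s sP] := weakly_primitive_products A (size f).
apply: (finite_upto_associates_label (s := s)
  (Q := fun t c => exists2 g, f = c%:P * g & associates g t)); last first.
  move=> t c c' _ _ [g fcg gt] [g' fcg' g't]; apply/polyC_associates.
  apply: (associates_cofactor f0 (a := g) (c := g')); rewrite 1?mulrC //.
  exact: associates_trans gt (associates_sym g't).
move=> c [[c0 cS] cmax].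
have [g fcg] : divides c%:P f by apply/fP.
have g0 : g != 0 by apply/eqP => g0; apply: f0; rewrite fcg g0 mulr0.
have [|||t ts gt] := sP g g0; last by exists t => //; exists g.
- move=> e [h gE].
  suff [u _ uE] : associates 1 e by exists u; rewrite mulrC.
  apply: (associatesMl c0); rewrite mulr1; apply: cmax; last by exists e.
  split=> [ce0|]; last first.
    by apply/fP; exists h; rewrite fcg gE polyCM mulrA.
  by apply: f0; rewrite fcg gE mulrA -polyCM ce0 polyC0 mul0r.
- by rewrite fcg mul_polyC size_scale ?leqnSn //; apply/eqP.
move=> p pA pg; apply: AC; split=> //.
by apply: divides_trans pg _; exists c%:P; rewrite mulrC.
Qed.

End Descent.

(** * Polynomials in an arbitrary set of variables *)

Section Polynomials.

Context {D : idomainType} {I : choiceType}.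
Local Notation A := {malg D[{cmonom I}]}.
Local Notation X := (fun i : I => mkmalgU (ucm i) (1 : D) : A).
Implicit Types (x y : A) (m : {cmonom I}) (i : I) (J K : seq I).

Definition supported J x : Prop :=
  forall m i, x@_m != 0 -> m i != 0%N -> i \in J.

Lemma divcmK m i : m i != 0%N -> mmul (divcm m (ucm i)) (ucm i) = m.
Proof.
move=> mi0; apply/eqP/cmP => j; rewrite cmM divcmE cmU subnK //.
by case: eqVneq => // <-; rewrite lt0n.
Qed.

Lemma mcoeffMX x i m :
  (x * X i)@_m = if m i == 0%N then 0 else x@_(divcm m (ucm i)).
Proof.
rewrite malgM_def fgmulgU raddf_sum /=.
under eq_bigr do rewrite mcoeffU mulr1.
have [mi0|mi0] := eqVneq.
  rewrite big1 // => k _; case: eqP => // kE.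
  by move: mi0; rewrite -kE cmM cmUU addn1.
have kP k : (mmul k (ucm i) == m) = (k == divcm m (ucm i)).
  apply/eqP/eqP => [<-|->]; last exact: divcmK.
  by apply/eqP/cmP => j; rewrite divcmE cmM addnK.
under eq_bigr do rewrite kP.
case: msuppP => [km|km].
  rewrite (big_fsetD1 _ km) /= eqxx mulr1n big1_fset ?addr0 // => k.
  by rewrite !inE => /andP[/negPf-> _] _.
rewrite big_seq big1 // => k kx; case: eqP => // kE.
by move: km; rewrite -kE kx.
Qed.

Lemma malgUX c m i : (mkmalgU m c : A) * X i = mkmalgU (mmul m (ucm i)) c.
Proof. by rewrite malgM_def fgmulUU mulr1. Qed.

Lemma supported_sub J K x : {subset J <= K} -> supported J x -> supported K x.
Proof. by move=> JK Jx m i xm mi; apply/JK/(Jx m). Qed.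

Lemma supportedD J x y : supported J x -> supported J y -> supported J (x + y).
Proof.
move=> Jx Jy m i; rewrite mcoeffD => xym.
have [x0|xm] := eqVneq x@_m 0; last exact: Jx.
by apply: Jy; move: xym; rewrite x0 add0r.
Qed.

Lemma supportedMX J i x : supported J x -> supported (i :: J) (x * X i).
Proof.
move=> Jx m j; rewrite mcoeffMX.
case: (eqVneq (m i)) => [_|mi0 xm mj]; first by rewrite eqxx.
rewrite inE; have [//|ji] := eqVneq j i; apply: (Jx _ _ xm).
by rewrite divcmE cmU (eq_sym i) (negPf ji) subn0.
Qed.

Lemma supported_vars x : exists J, supported J x.
Proof.
exists (flatten [seq enum_fset (finsupp m) | m <- msupp x]) => m i xm mi.
by apply/flatten_mapP; exists m; rewrite -?mcoeff_neq0 // -cmE_neq0.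
Qed.

Definition presents J (R : idomainType) (phi : R -> A) : Prop :=
  injective phi /\ forall x, supported J x <-> exists r, x = phi r.

Lemma presents_nil : presents [::] (@mkmalgU {cmonom I} D mone).
Proof.
split=> [|x]; first exact: (can_inj malgCK).
split=> [x0|[r ->] m i]; last first.
  rewrite mcoeffC; case: (eqVneq m) => [-> _|_]; first by rewrite cm1.
  by rewrite eqxx.
exists x@_mone; apply/malgP => m; rewrite mcoeffC.
case: eqVneq => [->//|m1]; apply/eqP; apply: contraNT m1 => xm.
apply/cmP => i; rewrite cm1; apply/eqP; apply: contraT => mi.
by have := x0 m i xm mi.
Qed.

(** The polynomials in the variables [i :: J] are the polynomials in the
    variable [i] over those in [J]: the isomorphism evaluates the new variable
    at [X i]. It is injective because, modulo [X i], only the constant term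
    survives, and multiplication by [X i] is injective. *)
Lemma presents_adjoin J i (R : idomainType) (phi : {rmorphism R -> A}) :
    i \notin J -> presents J phi ->
  exists psi : {rmorphism {poly R} -> A},
    presents (i :: J) psi /\ forall r, psi r%:P = phi r.
Proof.
move=> iJ [phi_inj phiJ].
have comX : commr_rmorph phi (X i) by move=> r; apply: mulrC.
have [psi [psiC psiX]] : exists psi : {rmorphism {poly R} -> A},
    (forall r, psi r%:P = phi r) /\ psi 'X = X i.
  exists (horner_morph comX); split=> [r|]; first exact: horner_morphC.
  exact: horner_morphX.
have psiMX p c : psi (p * 'X + c%:P) = psi p * X i + phi c.
  by rewrite rmorphD rmorphM psiC psiX.
exists psi; split=> //; split.
  suff ker p : psi p = 0 -> p = 0.
    by move=> p q pq; apply/subr0_eq/ker; rewrite rmorphB pq subrr.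
  elim/poly_ind: p => [//|p c IHp].
  rewrite psiMX => /malgP pc0.
  have c0 : c = 0.
    apply: phi_inj; rewrite rmorph0; apply/malgP => m; rewrite mcoeff0.
    have [mi0|mi0] := eqVneq (m i) 0%N.
      by have := pc0 m; rewrite mcoeffD mcoeffMX mi0 eqxx add0r mcoeff0.
    apply/eqP; apply: contraNT iJ => cm; have [_ Jc] := phiJ (phi c).
    by apply: Jc mi0 => //; exists c.
  rewrite c0 IHp ?mul0r ?add0r //; apply/malgP => m; rewrite mcoeff0.
  have := pc0 (mmul m (ucm i)).
  rewrite mcoeffD c0 rmorph0 !mcoeff0 addr0 mcoeffMX.
  rewrite cmM cmUU addn1 /=; congr (_@__ = _).
  by apply/eqP/cmP => j; rewrite divcmE cmM addnK.
move=> x; split=> [Jx|[p ->]]; last first.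
  elim/poly_ind: p => [|p c IHp].
    by rewrite rmorph0 => m j; rewrite mcoeff0 eqxx.
  rewrite psiMX; apply: supportedD.
    by apply: supported_sub (supportedMX IHp) => j; rewrite !inE orbA orbb.
  apply: (supported_sub (J := J)); last by apply/phiJ; exists c.
  by move=> j jJ; rewrite inE jJ orbT.
have monP n m c : (forall j, m j != 0%N -> j \in i :: J) -> m i = n ->
    exists p, mkmalgU m c = psi p.
  elim: n m => [|n IHn] m mJ mi.
    have [r rE] : exists r, mkmalgU m c = phi r.
      apply/phiJ => m' j; rewrite mcoeffU.
      case: (eqVneq m) => [<- _ mj|_]; last by rewrite eqxx.
      have := mJ j mj; rewrite inE => /predU1P[ji|//].
      by move: mj; rewrite ji mi.
    by exists r%:P; rewrite psiC.
  have [||p pE] := IHn (divcm m (ucm i)).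
  - move=> j; rewrite divcmE => mj; apply: mJ; apply: contraNneq mj => ->.
    by rewrite sub0n.
  - by rewrite divcmE cmUU mi subn1.
  have mi0 : m i != 0%N by rewrite mi.
  exists (p * 'X).
  rewrite rmorphM psiX -pE malgUX (divcmK mi0).
  reflexivity.
rewrite (monalgE x) big_seq; apply: (big_ind (fun y => exists p, y = psi p)).
- by exists 0; rewrite rmorph0.
- by move=> _ _ [p ->] [q ->]; exists (p + q); rewrite rmorphD.
move=> m; rewrite -mcoeff_neq0 => xm; apply: (monP (m i)) => // j.
exact: Jx.
Qed.

(** [P] is any property inherited by polynomial rings in one variable; the ring
    [R] is the iterated polynomial ring over [D]. *)
Lemma presentation (P : idomainType -> Prop) J :
    (forall R : idomainType, P R -> P {poly R}) -> P D -> uniq J ->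
  exists (R : idomainType) (phi : {rmorphism R -> A}), P R /\ presents J phi.
Proof.
move=> Ppoly PD; elim: J => [_|i J IHJ /= /andP[iJ Ju]].
  pose phi : {rmorphism D -> A} := @mkmalgU {cmonom I} D mone.
  exists D, phi; split; [exact: PD | exact: presents_nil].
have [R [phi [PR phiJ]]] := IHJ Ju.
have [psi [psiJ _]] := presents_adjoin iJ phiJ.
by exists {poly R}, psi; split=> //; apply: Ppoly.
Qed.

Lemma supported_undup J x : supported (undup J) x <-> supported J x.
Proof. by split; apply: supported_sub => i; rewrite mem_undup. Qed.

(** If the non-zero product [x * y] has degree zero in the variable [i], then
    so have [x] and [y], by integrality of the ring of polynomials in the other
    variables. The superfluous variables in [K] are removed in this way one at
    a time. *)
Lemma supported_divisor K J x y :
    supported (K ++ J) x -> supported (K ++ J) y -> x * y <> 0 ->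
  supported J (x * y) -> supported J x.
Proof.
move=> KJx KJy xy0 Jxy; elim: K KJx KJy => [//|i K IHK] iKJx iKJy.
have [iKJ|iKJ] := boolP (i \in K ++ J).
  have sub : {subset i :: K ++ J <= K ++ J}.
    by move=> j; rewrite inE => /predU1P[->|].
  by apply: IHK; apply: supported_sub sub _.
have KJu : uniq (undup (K ++ J)) by exact: undup_uniq.
have [R [phi [_ phiKJ]]] := presentation (P := fun=> True)
  (fun _ _ => Logic.I) Logic.I KJu.
have iKJ' : i \notin undup (K ++ J) by rewrite mem_undup.
have [psi [[psi_inj psiiKJ] psiC]] := presents_adjoin iKJ' phiKJ.
have lift z : supported (i :: K ++ J) z -> exists p, z = psi p.
  move=> Jz; apply/psiiKJ; apply: supported_sub Jz => j.
  by rewrite !inE mem_undup.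
have [[p xE] [q yE]] := (lift _ iKJx, lift _ iKJy).
have [r xyE] : exists r, x * y = phi r.
  have [_ phiE] := phiKJ; apply/phiE; apply: supported_sub Jxy => j jJ.
  by rewrite mem_undup mem_cat jJ orbT.
have r0 : r <> 0 by move=> r0; apply: xy0; rewrite xyE r0 rmorph0.
have pqr : p * q = r%:P by apply: psi_inj; rewrite rmorphM psiC -xE -yE.
have qpr : q * p = r%:P by rewrite mulrC.
have [b pE] := polyC_divisor_closed r0 pqr.
have [c qE] := polyC_divisor_closed r0 qpr.
have [_ phiE] := phiKJ.
by apply: IHK; apply/supported_undup/phiE; [exists b | exists c];
  rewrite ?xE ?yE ?pE ?qE psiC.
Qed.

Lemma malg_integral : GRing.integral_domain_axiom A.
Proof.
move=> x y xy0.
have [[J Jx] [K Ky]] := (supported_vars x, supported_vars y).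
have [R [phi [_ [phi_inj phiE]]]] := presentation (P := fun=> True)
  (fun _ _ => Logic.I) Logic.I (undup_uniq (J ++ K)).
have [a xE] : exists a, x = phi a.
  apply/phiE/supported_undup; apply: supported_sub Jx => i iJ.
  by rewrite mem_cat iJ.
have [b yE] : exists b, y = phi b.
  apply/phiE/supported_undup; apply: supported_sub Ky => i iJ.
  by rewrite mem_cat iJ orbT.
have : a * b == 0 by apply/eqP/phi_inj; rewrite rmorphM rmorph0 -xE -yE.
by rewrite mulf_eq0 xE yE => /orP[] /eqP->; rewrite rmorph0 eqxx ?orbT.
Qed.

Lemma IDF_malg : IDF_domain D -> MCD_finite_domain D -> IDF_domain A.
Proof.
move=> idfD mcdD; split=> [|x x0]; first exact: malg_integral.
have [J Jx] := supported_vars x.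
have [|R [phi [[idfR _] [phi_inj phiE]]]] := presentation
  (P := fun R => IDF_domain R /\ MCD_finite_domain R) _ (conj idfD mcdD)
  (undup_uniq J).
  by move=> R [idfR mcdR]; split; [apply: IDF_poly | apply: MCD_finite_poly].
have [r xE] : exists r, x = phi r by apply/phiE/supported_undup.
rewrite xE; apply: (proj2 (embedding_finite_atomic_divisors phi_inj _ _)).
- move=> y z s s0 yzE; apply/phiE/supported_undup.
  have [K Ky] := supported_vars y; have [L Lz] := supported_vars z.
  apply: (@supported_divisor (K ++ L) _ _ z).
  + by apply: supported_sub Ky => i; rewrite !mem_cat => ->.
  + by apply: supported_sub Lz => i; rewrite !mem_cat => ->; rewrite orbT.
  + by rewrite yzE -(rmorph0 phi) => /phi_inj.
  by rewrite yzE; apply/supported_undup/phiE; exists s.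
- by move=> r0; apply: x0; rewrite xE r0 rmorph0.
by have [_] := idfR; apply=> r0; apply: x0; rewrite xE r0 rmorph0.
Qed.

End Polynomials.

(** One variable indexed by [unit] gives back the univariate polynomial ring. *)
Lemma IDF_poly_of_malg (D : idomainType) :
  IDF_domain {malg D[{cmonom unit}]} -> IDF_domain {poly D}.
Proof.
move=> [_ idfA]; split=> [|f f0]; first exact: integral_domain.
have [psi [[psi_inj psiE] _]] :=
  presents_adjoin (isT : tt \notin [::]) (@presents_nil D unit).
have psi_surj x : exists p, x = psi p.
  by apply/psiE => m [] _ _; rewrite mem_head.
apply/(embedding_finite_atomic_divisors psi_inj _ f0) => [x y z _ _|].
  exact: psi_surj.
by apply: idfA => psif0; apply: f0; apply: psi_inj; rewrite rmorph0.
Qed.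

Theorem theorem2p1 (D : idomainType) :
  [<-> IDF_domain D /\ MCD_finite_domain D;
       IDF_domain {poly D};
       forall I : choiceType, IDF_domain {malg D[{cmonom I}]}].
Proof.
split=> [[idfD mcdD]|]; first exact: IDF_poly.
split=> [idfP I|idfA].
  by apply: IDF_malg; [exact: IDF_of_poly | exact: MCD_finite_of_poly].
have idfP : IDF_domain {poly D} by exact/IDF_poly_of_malg/idfA.
by split; [exact: IDF_of_poly | exact: MCD_finite_of_poly].
Qed.
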